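(* Let $0<s\le 1$. If there exists a tight $(\rho(s),\chi)$-bidding profile, then $\chi\ge\chi(s)$, where \[ \rho(s):=\frac{e^s}{s},\qquad \chi(s):=\begin{cases}(e^s-1)/s, & 0<s\le\ln 2,\\ \xi(s)/s, & \ln2\le s\le 1,\end{cases} \] and $\xi(s)$ is the unique solution $\xi\in[1,e]$ of $\xi(2-\ln\xi)=e^s$.
   Context: Given $1<\chi\le\rho$, a $(\rho,\chi)$-bidding profile is a non-decreasing, left-continuous $G:\mathbb{R}\to(0,\infty)$ such that (offset) $G(x)<1$ for $x<0$ and $G(x)\ge1$ for $x>0$; (robustness) $\int_{-\infty}^{x+1}G(t)\,\mathrm{d} t\le\rho G(x)$ for all $x\in\mathbb{R}$; (consistency) $\int_{-\infty}^1G(t)\,\mathrm{d} t\le\chi$. It is tight if additionally $\int_{-\infty}^{x+1}G(t)\,\mathrm{d} t=\rho G(x)$ for all $x\le0$ and $\int_{-\infty}^1G(t)\,\mathrm{d} t=\chi$. *)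

(* Defs.v *)
From HB Require Import structures.
From mathcomp Require Import all_boot all_order all_algebra.
From mathcomp Require Import all_classical all_reals all_analysis.
Set Implicit Arguments. Unset Strict Implicit. Unset Printing Implicit Defensive.
Import Order.TTheory GRing.Theory Num.Theory.
Import numFieldNormedType.Exports.
Local Open Scope classical_set_scope.
Local Open Scope ring_scope.

Definition int_upto {R : realType} (G : R -> R) (b : R) : \bar R :=
  (\int[@lebesgue_measure R]_(t in `]-oo, b]) (G t)%:E)%E.

Definition bidding_profile {R : realType} (rho chi : R) (G : R -> R) : Prop :=
  [/\ {homo G : x y / x <= y} /\ (forall x : R, G @ x^'- --> G x),
      (forall x : R, 0 < G x),
      ((forall x : R, x < 0 -> G x < 1) /\ (forall x : R, 0 < x -> 1 <= G x)),
      (forall x : R, (int_upto G (x + 1) <= (rho * G x)%:E)%E) &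
      (int_upto G 1 <= chi%:E)%E].

Definition tight_bidding_profile {R : realType} (rho chi : R) (G : R -> R) : Prop :=
  [/\ bidding_profile rho chi G,
      (forall x : R, x <= 0 -> int_upto G (x + 1) = (rho * G x)%:E) &
      int_upto G 1 = chi%:E].

Definition rho_s {R : realType} (s : R) : R := expR s / s.

Definition xi_s {R : realType} (s : R) : R :=
  xget 0 [set x : R | 1 <= x <= expR 1 /\ x * (2 - ln x) = expR s].

Definition chi_s {R : realType} (s : R) : R :=
  if s <= ln 2 then (expR s - 1) / s else xi_s s / s.

(* Main.v *)
Require Import Defs.
From HB Require Import structures.
From mathcomp Require Import all_boot all_order all_algebra.
From mathcomp Require Import all_classical all_reals all_analysis.
From mathcomp Require Import measurable_realfun.
From mathcomp Require Import ring lra.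
Import Order.TTheory GRing.Theory Num.Theory.
Local Open Scope ring_scope.
Set Implicit Arguments.
Unset Strict Implicit.

(** Let F x be the integral of G up to x. As G is monotone, F is convex with
    subgradient G, and robustness reads G x >= s e^(-s) F (x + 1).

    Iterating this inequality shows G >= s F, so H x = e^(-s x) F x is
    nondecreasing; hence G x >= c e^(s x) for x >= 0, where
    c = s e^(-s) F 1. Robustness also makes
    J x = H x - s * (integral of H over [x, x + 1]) nondecreasing, and since
    J (- k) >= H (- k) - H (1 - k) telescopes in k while H stays positive,
    J 0 >= 0. Integration by parts turns J 0 >= 0 into
    e^(-s) chi >= integral over [0, 1] of e^(-s t) G t.

    Inserting G >= 1 gives chi >= (e^s - 1) / s. Inserting
    G t >= max (1, c e^(s t)) gives xi (2 - ln xi) >= e^s for xi = s chi, and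
    x (2 - ln x) is increasing up to x = e. *)

(** * Monotonicity from increments, without derivatives *)

Section subdivision.
Context {R : realType}.
Implicit Types (a b c x y h : R) (D K : R -> R).

Lemma le0_of_mulrn_bounded c x : (forall n : nat, n%:R * x <= c) -> x <= 0.
Proof.
move=> xc; rewrite leNgt; apply/negP => x0.
have c0 : 0 <= c by have := xc 0%N; rewrite mul0r.
have := archi_boundP (divr_ge0 c0 (ltW x0)).
by rewrite ltr_pdivrMr// ltNge xc.
Qed.

(* Over n equal steps of length h the errors telescope to h (K b - K a). *)
Lemma le_of_increment_ge D K a b : a <= b -> {homo K : x y / x <= y} ->
  (forall x y, a <= x -> x <= y -> y <= b ->
    - ((y - x) * (K y - K x)) <= D y - D x) ->
  D a <= D b.
Proof.
move=> ab Kmon DK.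
have step (h : R) (n : nat) : 0 <= h -> a + n%:R * h <= b ->
    - (h * (K (a + n%:R * h) - K a)) <= D (a + n%:R * h) - D a.
  move=> h0; elim: n => [|n IH] nb.
    by rewrite mul0r addr0 !subrr mulr0 oppr0.
  have nh : 0 <= n%:R * h by rewrite mulr_ge0.
  have e : a + n.+1%:R * h = a + n%:R * h + h by rewrite -natr1; ring.
  rewrite e in nb *.
  have := IH ltac:(lra).
  have := DK (a + n%:R * h) (a + n%:R * h + h) ltac:(lra) ltac:(lra) nb.
  set u := a + n%:R * h; rewrite (_ : u + h - u = h); last by ring.
  by lra.
rewrite -subr_le0; apply: (@le0_of_mulrn_bounded ((b - a) * (K b - K a))).
case=> [|n]; first by rewrite mul0r mulr_ge0// subr_ge0// Kmon.
have n0 : 0 < n.+1%:R :> R by [].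
have e : a + n.+1%:R * ((b - a) / n.+1%:R) = b by rewrite mulrC divfK ?gt_eqF//; ring.
have := step ((b - a) / n.+1%:R) n.+1.
rewrite e => /(_ _ (lexx _)); rewrite divr_ge0 ?subr_ge0// => /(_ isT).
rewrite -(ler_pM2l n0).
rewrite (_ : n.+1%:R * - _ = - ((b - a) * (K b - K a))); first by lra.
by rewrite mulrN mulrA (mulrCA n.+1%:R) divff ?gt_eqF// mulr1.
Qed.

End subdivision.

(** * Monotone functions as subgradients of their integrals *)

Section subgradient.
Context {R : realType}.
Local Open Scope classical_set_scope.
Implicit Types (l : itv_bound R) (h : R -> R) (a x y : R).

Let mu := @lebesgue_measure R.

Lemma nondecreasing_measurable_EFin h (A : set R) : measurable A ->
  {homo h : x y / x <= y} -> measurable_fun A (fun t => (h t)%:E).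
Proof.
move=> mA hmon; apply/measurable_EFinP.
by apply: nondecreasing_measurable => // x y _ _; exact: hmon.
Qed.

Lemma integral_itv_oc_nondecreasing h x y : {homo h : x y / x <= y} ->
  (forall t, 0 <= h t) -> x <= y ->
  ((h x * (y - x))%:E <= \int[mu]_(t in `]x, y]) (h t)%:E <=
   (h y * (y - x))%:E)%E.
Proof.
move=> hmon h0 xy.
have mh : measurable_fun `]x, y] (fun t => (h t)%:E) by exact: nondecreasing_measurable_EFin.
have cstE (c : R) : (\int[mu]_(t in `]x, y]) cst c%:E t = (c * (y - x))%:E)%E.
  rewrite integral_cst//= lebesgue_measure_itv/= lte_fin.
  move: xy; rewrite le_eqVlt => /predU1P[->|->].
    by rewrite ltxx subrr mulr0 mule0.
  by rewrite -EFinB -EFinM.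
rewrite -!cstE; apply/andP; split; apply: ge0_le_integral => //= t;
  rewrite ?in_itv/= => /andP[xt ty]; rewrite lee_fin ?h0//.
- by apply: hmon; exact: ltW.
- exact: hmon.
Qed.

(** The integral between [x] and [y] is at least [h x] times the length if [x <= y], and at most
    that if [y < x]. The left end [l] is general so as to cover both [int_upto] and integrals from a
    finite point. *)
Lemma integral_subgradient l h x y : {homo h : x y / x <= y} ->
  (forall t, 0 <= h t) -> (l <= BRight x)%O -> (l <= BRight y)%O ->
  let F z := (\int[mu]_(t in [set` Interval l (BRight z)]) (h t)%:E)%E in
  F x \is a fin_num -> F y \is a fin_num ->
  h x * (y - x) <= fine (F y) - fine (F x).
Proof.
move=> hmon h0 + + F.
have inc u v : (l <= BRight u)%O -> u <= v ->
    F v = (F u + \int[mu]_(t in `]u, v]) (h t)%:E)%E.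
  move=> lu uv; rewrite /F (@itv_bndbnd_setU _ _ l (BRight u) (BRight v))//.
  rewrite ge0_integral_setU//=.
  - apply: nondecreasing_measurable_EFin => //; exact: measurableU.
  - by move=> t _; rewrite lee_fin.
  - apply/disj_setPS => t /= []; rewrite !itv_boundlr => /andP[_ tu] /andP[ut _].
    by move: tu ut; rewrite !bnd_simp => /le_lt_trans h1 /h1; rewrite ltxx.
case: (leP x y) => xy lx ly.
  rewrite (inc _ _ lx xy) => Fx; rewrite fin_numD => /andP[_ I].
  rewrite (fineD Fx I) addrAC subrr add0r -lee_fin fineK//.
  by have /andP[] := integral_itv_oc_nondecreasing hmon h0 xy.
rewrite (inc _ _ ly (ltW xy)) fin_numD => /andP[_ I] Fy.
rewrite (fineD Fy I) opprD addNKr lerNr -mulrN opprB -lee_fin fineK//.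
by have /andP[] := integral_itv_oc_nondecreasing hmon h0 (ltW xy).
Qed.

(** The finite base point [a] keeps the integral finite even when [h] has a positive limit at minus
    infinity. *)
Lemma exists_subgradient_primitive h a : {homo h : x y / x <= y} ->
  (forall t, 0 <= h t) ->
  exists Phi : R -> R, forall x y, a <= x -> a <= y ->
    h x * (y - x) <= Phi y - Phi x.
Proof.
move=> hmon h0.
exists (fun x => fine (\int[mu]_(t in `]a, x]) (h t)%:E)%E) => x y ax ay.
have fin z : a <= z -> (\int[mu]_(t in `]a, z]) (h t)%:E)%E \is a fin_num.
  move=> az; have /andP[I1 I2] := integral_itv_oc_nondecreasing hmon h0 az.
  rewrite fin_numE; apply/andP; split.
  - by apply: contraTneq I1 => ->; rewrite leeNy_eq.
  - by apply: contraTneq I2 => ->; rewrite leye_eq.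
by apply: integral_subgradient => //; exact: fin.
Qed.

End subgradient.

(** * Growth forced by the advanced inequality *)

Section advanced_inequality.
Context {R : realType}.
Variables (s : R) (F G : R -> R).
Hypotheses (s_gt0 : 0 < s) (s_le1 : s <= 1) (F_gt0 : forall x, 0 < F x).
Hypothesis F_subgradient : forall x y, G x * (y - x) <= F y - F x.
Hypothesis F_shift : forall x, s * expR (- s) * F (x + 1) <= G x.

Let G_gt0 x : 0 < G x.
Proof. by apply: lt_le_trans (F_shift x); rewrite !mulr_gt0 ?expR_gt0. Qed.

Let F_mono : {homo F : x y / x <= y}.
Proof.
move=> x y xy; rewrite -subr_ge0; apply: le_trans (F_subgradient x y).
by rewrite mulr_ge0 ?subr_ge0// ltW.
Qed.

Let expRN_step (m x y : R) : expR (- (m * x)) * (1 - m * (y - x)) <= expR (- (m * y)).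
Proof.
rewrite (_ : - (m * y) = - (m * x) + - (m * (y - x))); last by ring.
by rewrite expRD ler_pM2l ?expR_gt0// expR_ge1Dx.
Qed.

(** Formally the derivative is e^(-m x) (G x - m F x) >= 0. Over a step d, the factors 1 - m d for
    the exponential and 1 + m d for [F] lose only (m d)^2, which the linear function m^2 C x pays
    for; [C] bounds e^(-m x) F x on [a, b]. *)
Lemma exp_normalised_mono (m : R) : 0 <= m -> (forall x, m * F x <= G x) ->
  {homo (fun x => expR (- (m * x)) * F x) : x y / x <= y}.
Proof.
move=> m0 mG a b ab.
pose C := expR (- (m * a)) * F b.
have C0 : 0 <= C by rewrite mulr_ge0 ?expR_ge0// ltW.
apply: (@le_of_increment_ge _ (fun x => expR (- (m * x)) * F x)
  (fun x => m ^+ 2 * C * x)) => // [x y xy|x y ax xy yb] /=.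
  by rewrite ler_wpM2l// mulr_ge0// sqr_ge0.
have := expRN_step m x y; have := F_subgradient x y; have := mG x.
have : expR (- (m * x)) * F x <= C.
  rewrite ler_pM ?expR_ge0//; [exact: ltW| |by apply: F_mono; lra].
  by rewrite ler_expR lerN2 ler_wpM2l.
have := expR_gt0 (- (m * x)); have := expR_gt0 (- (m * y)).
have := F_gt0 x; have : 0 <= y - x by lra.
set p := expR (- (m * x)); set q := expR (- (m * y)); set d := y - x.
move=> d0 Fx0 q0 p0 pC mGx FG pq.
have Fy : F x * (1 + m * d) <= F y.
  have : m * F x * d <= G x * d by rewrite ler_wpM2r.
  by lra.
have md : 0 <= m * d by rewrite mulr_ge0.
have : p * (1 - m * d) * (F x * (1 + m * d)) <= q * F y.
  apply: (@le_trans _ _ (q * (F x * (1 + m * d)))).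
    by rewrite ler_wpM2r// mulr_ge0// ?ltW//; lra.
  by rewrite ler_wpM2l// ltW.
have : (m * d) ^+ 2 * (p * F x) <= (m * d) ^+ 2 * C.
  by rewrite ler_wpM2l// sqr_ge0.
rewrite (_ : m ^+ 2 * C * y - m ^+ 2 * C * x = m ^+ 2 * C * d); last by rewrite /d; ring.
rewrite (_ : d * _ = (m * d) ^+ 2 * C); last by ring.
rewrite (_ : p * (1 - m * d) * _ = p * F x - (m * d) ^+ 2 * (p * F x)); last by ring.
by lra.
Qed.

(* The best constant m with m F <= G satisfies s e^(m - s) <= m, because
   G x >= s e^(-s) F (x + 1) >= s e^(m - s) F x; on [0, s] this forces m = s. *)
Lemma log_derivative_ge x : s * F x <= G x.
Proof.
pose A : set R := [set m | 0 <= m <= s /\ forall x, m * F x <= G x]%classic.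
have A0 : A 0.
  by split=> [|z]; [rewrite lexx ltW | rewrite mul0r ltW].
have supA : has_sup A by split; [exists 0 | exists s => m [/andP[]]].
have supA_lb m : A m -> m <= sup A by move=> Am; exact: (sup_upper_bound supA).
have supA_ub u : (forall m, A m -> m <= u) -> sup A <= u.
  by move=> Au; apply: sup_le_ub; [case: supA | move=> m; exact: Au].
move: (sup A) supA_lb supA_ub => M supA_lb supA_ub.
have M0 : 0 <= M by exact: supA_lb.
have Ms : M <= s by apply: supA_ub => m [/andP[]].
have MG z : M * F z <= G z.
  rewrite -ler_pdivlMr//; apply: supA_ub => m [_ /(_ z)].
  by rewrite ler_pdivlMr.
have : A (s * expR (M - s)).
  split=> [|z].
    rewrite mulr_ge0 ?expR_ge0 ?(ltW s_gt0)//= -[leRHS]mulr1 ler_pM2l//.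
    by rewrite -expR0 ler_expR; lra.
  apply: le_trans (F_shift z); rewrite expRD.
  rewrite (_ : _ * F z = s * expR (- s) * (expR M * F z)); last by ring.
  rewrite ler_pM2l ?mulr_gt0 ?expR_gt0//.
  have zz1 : z <= z + 1 by rewrite lerDl.
  have /= := exp_normalised_mono M0 MG zz1.
  rewrite mulrDr mulr1 opprD expRD -mulrA ler_pM2l ?expR_gt0//.
  by rewrite (expRN M) mulrC ler_pdivlMr ?expR_gt0// mulrC.
move/supA_lb => sM.
have [<-|MNs] := eqVneq M s; first exact: MG.
(* With s e^(M - s) <= M this gives (s - M) (1 - s) < 0, against [M <= s <= 1]. *)
have : 1 + (M - s) < expR (M - s) by apply: expR_gt1Dx; rewrite subr_eq0.
rewrite -(ltr_pM2l s_gt0) => sM'.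
have : 0 <= (s - M) * (1 - s) by rewrite mulr_ge0// subr_ge0.
lra.
Qed.

Let H x := expR (- (s * x)) * F x.

Lemma normalised_mono : {homo H : x y / x <= y}.
Proof. by apply: exp_normalised_mono log_derivative_ge; exact: ltW. Qed.

Let H_gt0 x : 0 < H x. Proof. by rewrite mulr_gt0 ?expR_gt0. Qed.

(** * The delay functional and integration by parts *)

Section primitive.
Variables (a : R) (Phi : R -> R).
Hypothesis Phi_subgradient :
  forall x y, a <= x -> a <= y -> H x * (y - x) <= Phi y - Phi x.

Let E x := H x - s * (Phi (x + 1) - Phi x).

(** [E] is J with [Phi] as primitive of [H]. Formally H' = e^(-s x) (G x - s F x) >= s (H (x + 1) -
    H x), and the right side is the derivative of the subtracted term. *)
Let E_mono x y : a <= x -> x <= y -> E x <= E y.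
Proof.
move=> ax xy.
(* The first term of the error function pays for [H (v + 1)] replacing [H (u + 1)] in the increment
   of [Phi], the second for the quadratic loss of the tangent bound on the exponential. *)
apply: (@le_of_increment_ge _ E (fun z => s * (H (z + 1) + s * H (y + 1) * z))) => //.
  move=> u v uv; rewrite ler_pM2l// lerD//; first by apply: normalised_mono; rewrite lerD2r.
  by rewrite ler_wpM2l// ltW// mulr_gt0.
move=> u v xu uv vy.
have d0 : 0 <= v - u by lra.
have I1 : Phi (v + 1) - Phi (u + 1) <= H (v + 1) * (v - u).
  by have := @Phi_subgradient (v + 1) (u + 1) ltac:(lra) ltac:(lra); lra.
have I2 : H u * (v - u) <= Phi v - Phi u by apply: Phi_subgradient; lra.
have I3 : H (u + 1) <= H (y + 1) by apply: normalised_mono; lra.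
have I4 := expRN_step s u v.
have I5 : F u + s * expR (- s) * F (u + 1) * (v - u) <= F v.
  have : s * expR (- s) * F (u + 1) * (v - u) <= G u * (v - u) by rewrite ler_wpM2r.
  by have := F_subgradient u v; lra.
have I6 : expR (- (s * v)) * F u >= H u - s * (v - u) * H u.
  have : expR (- (s * u)) * (1 - s * (v - u)) * F u <= expR (- (s * v)) * F u.
    by rewrite ler_pM2r.
  by rewrite /H; lra.
have I7 : expR (- (s * v)) * (s * expR (- s) * F (u + 1) * (v - u)) >=
    s * (v - u) * (H (u + 1) - s * (v - u) * H (u + 1)).
  have : expR (- (s * u)) * (1 - s * (v - u)) * (expR (- s) * F (u + 1))
      <= expR (- (s * v)) * (expR (- s) * F (u + 1)).
    by rewrite ler_wpM2r// mulr_ge0 ?expR_ge0// ltW.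
  move=> /(ler_wpM2l (mulr_ge0 (ltW s_gt0) d0)).
  rewrite /H (_ : - (s * (u + 1)) = - (s * u) + - s); last by ring.
  by rewrite expRD; lra.
have I8 : H v >= expR (- (s * v)) * (F u + s * expR (- s) * F (u + 1) * (v - u)).
  by rewrite ler_wpM2l ?expR_ge0.
have I9 : s * (v - u) * (s * (v - u) * H (u + 1)) <= s * (v - u) * (s * (v - u) * H (y + 1)).
  by rewrite !ler_wpM2l ?mulr_ge0// ltW.
have I10 : s * (Phi (v + 1) - Phi (u + 1)) <= s * (H (v + 1) * (v - u)).
  by rewrite ler_pM2l.
have I11 : s * (H u * (v - u)) <= s * (Phi v - Phi u) by rewrite ler_pM2l.
rewrite /E; lra.
Qed.

(* Each unit step gives - E 0 <= - E (- k) <= H (1 - k) - H (- k), and these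
   bounds telescope. *)
Lemma delay_functional_lower_bound (n : nat) : a <= - n%:R ->
  n%:R * (s * (Phi 1 - Phi 0) - H 0) <= H 1 - H (1 - n%:R).
Proof.
elim: n => [|n IH] an; first by rewrite mul0r subr0 subrr.
have n0 : 0 <= n%:R :> R by [].
rewrite -natr1 in an *; have := IH ltac:(lra).
have E0 : E (- n%:R) <= E 0 by apply: E_mono; lra.
have P1 : Phi (- n%:R + 1) - Phi (- n%:R) <= H (- n%:R + 1).
  by have := @Phi_subgradient (- n%:R + 1) (- n%:R) ltac:(lra) ltac:(lra); lra.
(* Dropping the factor [s <= 1] makes the bounds telescope. *)
have P2 : s * (Phi (- n%:R + 1) - Phi (- n%:R)) <= H (- n%:R + 1).
  apply: le_trans (_ : s * H (- n%:R + 1) <= _); first by rewrite ler_pM2l.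
  by rewrite ler_piMl// ltW.
move: E0; rewrite /E add0r (addrC 1 (- n%:R)) (_ : 1 - (n%:R + 1) = - n%:R); last by ring.
lra.
Qed.

(** Integration by parts: formally s Phi + H has derivative e^(-s x) G x, so it outgrows any [B]
    whose slope is at most that, up to an error controlled by [K]. *)
Lemma increment_lower_bound (B K : R -> R) u v : a <= u -> u <= v ->
  {homo K : x y / x <= y} ->
  (forall x y, u <= x -> x <= y -> y <= v ->
    B y - B x <= (y - x) * (expR (- (s * y)) * G x + (K y - K x))) ->
  B v - B u <= s * (Phi v - Phi u) + H v - H u.
Proof.
move=> au uv Kmon BK.
suff : s * Phi u + H u - B u <= s * Phi v + H v - B v by lra.
apply: (@le_of_increment_ge _ (fun z => s * Phi z + H z - B z) K) => // x y ux xy yv.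
have d0 : 0 <= y - x by lra.
have I1 : s * (H x * (y - x)) <= s * (Phi y - Phi x).
  by rewrite ler_pM2l//; apply: Phi_subgradient; lra.
have I2 := BK x y ux xy yv.
have I3 : expR (- (s * y)) * (F x + G x * (y - x)) <= H y.
  by rewrite ler_wpM2l ?expR_ge0//; have := F_subgradient x y; lra.
have I4 : H x - s * (y - x) * H x <= expR (- (s * y)) * F x.
  have : expR (- (s * x)) * (1 - s * (y - x)) * F x <= expR (- (s * y)) * F x.
    by rewrite ler_pM2r.
  by rewrite /H; lra.
lra.
Qed.

Lemma increment_lower_bound_of_ge1 v : a <= 0 -> 0 <= v ->
  (forall x, 0 < x -> 1 <= G x) ->
  (1 - expR (- (s * v))) / s <= s * (Phi v - Phi 0) + H v - H 0.
Proof.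
move=> a0 v0 G1; move: v0; rewrite le_eqVlt => /predU1P[<-|v0].
  by rewrite mulr0 oppr0 expR0 !subrr mul0r mulr0 add0r subrr.
(* The bound on [G] holds only right of 0, while increments sample [G] at left endpoints. So [0, e]
   is split off; it costs at most [eps]. *)
apply/ler_addgt0Pl => eps eps0; pose e := Num.min eps v.
have e0 : 0 < e by rewrite lt_min eps0.
have ev : e <= v by rewrite ge_min lexx orbT.
have ee : e <= eps by rewrite ge_min lexx.
have I1 : 0 <= s * (Phi e - Phi 0) + H e - H 0.
  have := @increment_lower_bound (fun=> 0) (fun=> 0) 0 e a0 (ltW e0).
  rewrite subrr; apply=> // x y _ xy _.
  by rewrite addr0 !mulr_ge0 ?subr_ge0 ?expR_ge0// ltW.
have I2 : (- expR (- (s * v))) / s - (- expR (- (s * e))) / s <=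
    s * (Phi v - Phi e) + H v - H e.
  apply: (@increment_lower_bound (fun x => - expR (- (s * x)) / s)
    (fun x => - expR (- (s * x)))) => //; first by lra.
    by move=> x y xy; rewrite lerN2 ler_expR lerN2 ler_pM2l.
  move=> x y ex xy yv; rewrite -mulrBl ler_pdivrMr//.
  have := @expRN_step s x y.
  have : expR (- (s * y)) * 1 <= expR (- (s * y)) * G x.
    by rewrite ler_pM2l ?expR_gt0// G1//; lra.
  rewrite mulr1 => J1 J2.
  have : s * (y - x) * expR (- (s * y)) <= s * (y - x) * (expR (- (s * y)) * G x).
    by rewrite ler_wpM2l// mulr_ge0 ?subr_ge0// ltW.
  lra.
have I3 : (1 - expR (- (s * e))) / s <= e.
  by rewrite ler_pdivrMr//; have := expR_ge1Dx (- (s * e)); lra.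
lra.
Qed.

(** The weight e^(-s x) turns c e^(s x) into the constant [c]. *)
Lemma increment_lower_bound_of_exp c u v : a <= u -> u <= v -> 0 <= c ->
  (forall x, u <= x -> c * expR (s * x) <= G x) ->
  c * (v - u) <= s * (Phi v - Phi u) + H v - H u.
Proof.
move=> au uv c0 Gc; rewrite mulrBr.
apply: (@increment_lower_bound ( *%R c) ( *%R (c * s))) => //.
  by move=> x y xy; rewrite ler_wpM2l// mulr_ge0// ltW.
move=> x y ux xy yv.
have d0 : 0 <= y - x by lra.
rewrite -mulrBr mulrC ler_wpM2l//.
have : expR (- (s * y)) * (c * expR (s * x)) <= expR (- (s * y)) * G x.
  by rewrite ler_pM2l ?expR_gt0// Gc.
have : c * (1 - s * (y - x)) <= c * expR (- (s * (y - x))).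
  by rewrite ler_wpM2l// expR_ge1Dx.
rewrite (_ : - (s * (y - x)) = - (s * y) + s * x); last by ring.
rewrite expRD; lra.
Qed.

End primitive.

(** The two bounds on [G] are used on either side of [u]. For each n, a primitive started at -n
    shows that n times the gap is at most [H 1], so the gap is nonpositive. *)
Lemma value_at1_lower_bound c u : 0 <= u -> u <= 1 -> 0 <= c ->
  (forall x, 0 < x -> 1 <= G x) ->
  (forall x, u <= x -> c * expR (s * x) <= G x) ->
  (1 - expR (- (s * u))) / s + c * (1 - u) <= expR (- s) * F 1.
Proof.
move=> u0 u1 c0 G1 Gc; rewrite -subr_le0.
apply: (@le0_of_mulrn_bounded _ (H 1)) => n.
have n0 : 0 <= n%:R :> R by [].
have [Phi HPhi] := @exists_subgradient_primitive _ H (- n%:R) normalised_mono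
  (fun t => ltW (H_gt0 t)).
have := @delay_functional_lower_bound _ Phi HPhi n (lexx _).
have := @increment_lower_bound_of_ge1 _ Phi HPhi u ltac:(lra) u0 G1.
have := @increment_lower_bound_of_exp _ Phi HPhi c u 1 ltac:(lra) u1 c0 Gc.
have <- : H 1 = expR (- s) * F 1 by rewrite /H mulr1.
move=> I1 I2 I3; have := H_gt0 (1 - n%:R).
have : n%:R * ((1 - expR (- (s * u))) / s + c * (1 - u) - H 1) <=
  n%:R * (s * (Phi 1 - Phi 0) - H 0) by rewrite ler_wpM2l//; lra.
lra.
Qed.

(** Monotonicity of [H] from 1 to x + 1 gives F (x + 1) >= e^(s x) F 1. *)
Lemma exp_lower_bound x : 0 <= x -> s * expR (- s) * F 1 * expR (s * x) <= G x.
Proof.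
move=> x0; apply: le_trans (F_shift x).
rewrite -mulrA ler_pM2l ?mulr_gt0 ?expR_gt0//.
have := normalised_mono (_ : 1 <= x + 1); rewrite /H => /(_ ltac:(lra)).
rewrite mulrDr mulr1 opprD (addrC (- (s * x))) expRD -mulrA ler_pM2l ?expR_gt0//.
by rewrite expRN mulrC ler_pdivlMr ?expR_gt0.
Qed.

End advanced_inequality.

Section xi.
Context {R : realType}.

(** If x < y, put t = ln y - ln x. Then y = x e^t with e^t > 1 + t, and (1 + t) (2 - ln y) exceeds 2
    - ln x by t (1 - ln y) >= 0. *)
Lemma le_of_xi_equation_le (x y : R) : 0 < x -> 0 < y -> y <= expR 1 ->
  y * (2 - ln y) <= x * (2 - ln x) -> y <= x.
Proof.
move=> x0 y0 ye xy2; rewrite leNgt; apply/negP => xy; move: xy2.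
apply/negP; rewrite -ltNge.
have lxy : ln x < ln y by rewrite ltr_ln.
have ly1 : ln y <= 1 by rewrite -(expRK 1) ler_ln ?posrE ?expR_gt0.
have yE : y = x * expR (ln y - ln x).
  by rewrite expRD expRN !lnK ?posrE// mulrC divfK// gt_eqF.
have e1 : 1 + (ln y - ln x) < expR (ln y - ln x) by rewrite expR_gt1Dx// subr_eq0 gt_eqF.
rewrite {1}yE -mulrA ltr_pM2l//.
have : (1 + (ln y - ln x)) * (2 - ln y) < expR (ln y - ln x) * (2 - ln y).
  by rewrite ltr_pM2r//; lra.
have : 0 <= (ln y - ln x) * (1 - ln y) by rewrite mulr_ge0//; lra.
lra.
Qed.

End xi.

Theorem theorem3 (R : realType) (s chi : R) :
  0 < s -> s <= 1 -> 1 < chi -> chi <= rho_s s ->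
  (exists G : R -> R, tight_bidding_profile (rho_s s) chi G) ->
  chi_s s <= chi.
Proof.
move=> s0 s1 chi1 chirho [G [[[Gmon _] G0 [_ G1] Grob _] _ Gchi]].
have fin x : int_upto G x \is a fin_num.
  rewrite ge0_fin_numE; last by apply: integral_ge0 => t _; rewrite lee_fin ltW.
  by have := Grob (x - 1); rewrite subrK => /le_lt_trans -> //; rewrite ltry.
pose F x := fine (int_upto G x).
have Fsub x y : G x * (y - x) <= F y - F x.
  by apply: integral_subgradient => //; [move=> t; exact: ltW|exact: fin|exact: fin].
have F0 x : 0 < F x.
  have : 0 <= F (x - 1) by apply/fine_ge0/integral_ge0 => t _; rewrite lee_fin ltW.
  by have := Fsub (x - 1) x; have := G0 (x - 1); lra.
have Frob x : s * expR (- s) * F (x + 1) <= G x.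
  have := Grob x; rewrite -(fineK (fin (x + 1))) lee_fin -/(F _) /rho_s.
  have e0 := expR_gt0 s.
  rewrite expRN (_ : expR s / s * G x = G x / (s / expR s)); last first.
    by field; rewrite !gt_eqF.
  by rewrite ler_pdivlMr ?divr_gt0// mulrC.
have F1 : F 1 = chi by rewrite /F Gchi.
have e0 : 0 < expR s := expR_gt0 s.
have chi_exp : (expR s - 1) / s <= chi.
  (* Taking u = 1 and c = 0 uses only G >= 1. *)
  have := value_at1_lower_bound s0 s1 F0 Fsub Frob ler01 (lexx 1) (lexx 0) G1.
  rewrite subrr mulr0 addr0 F1 mulr1 => /(_ _)/wrap[].
    by move=> x x1; rewrite mul0r ltW.
  rewrite expRN -(ler_pM2l e0) mulVKf ?gt_eqF//; apply: le_trans.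
  by rewrite mulrA mulrBr mulr1 mulfV ?gt_eqF.
rewrite /chi_s; case: ifPn => [//|]; rewrite -ltNge => s2.
have xi1 : 1 <= s * chi.
  have : 2 < expR s by rewrite -[X in X < _](@lnK _ 2) ?posrE// ltr_expR.
  by move: chi_exp; rewrite ler_pdivrMr// mulrC; lra.
have xi0 : 0 < s * chi by lra.
have xi_le : s * chi <= expR s by move: chirho; rewrite /rho_s ler_pdivlMr// mulrC.
(* In the branch without a solution [xget] returns 0, and 0 <= chi closes it. *)
rewrite /xi_s; case: xgetP => [x -> /= [/andP[x1 xe] xE]|_]; last by rewrite mul0r; lra.
rewrite ler_pdivrMr// mulrC; apply: le_of_xi_equation_le => //; first by lra.
rewrite {}xE.
pose L := ln (s * chi).
have L0 : 0 <= L by rewrite ln_ge0.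
have Ls : L <= s by rewrite -(expRK s) ler_ln ?posrE.
(* The crossing point of the two bounds: c e^(s u) = 1 for c = s e^(-s) chi. It lies in [0, 1]
   because 1 <= s chi <= e^s. *)
pose u := 1 - L / s.
have u0 : 0 <= u by rewrite subr_ge0 ler_pdivrMr// mul1r.
have u1 : u <= 1 by rewrite gerBl divr_ge0// ltW.
have su : expR (- (s * u)) = expR (- s) * (s * chi).
  rewrite (_ : - (s * u) = - s + L); last by rewrite /u; field; rewrite gt_eqF.
  by rewrite expRD lnK.
have c0 : 0 <= s * expR (- s) * F 1 by rewrite !mulr_ge0 ?expR_ge0// ltW.
have := value_at1_lower_bound s0 s1 F0 Fsub Frob u0 u1 c0 G1
  (fun x ux => exp_lower_bound s0 s1 F0 Fsub Frob (le_trans u0 ux)).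
(* Scaling by s e^s turns the bound into e^s - s chi + s chi L <= s chi. *)
rewrite su F1 expRN -(ler_pM2l (mulr_gt0 s0 e0)).
rewrite (_ : s * expR s * (_ + _) = expR s - s * chi + s * chi * L); last first.
  by rewrite /u; field; rewrite !gt_eqF.
rewrite (_ : s * expR s * (_ * chi) = s * chi); last by field; rewrite gt_eqF.
by rewrite -/L; lra.
Qed.
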